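(* Let $(\epsilon_1,\dots,\epsilon_N)$ be a sequentially dependent sequence of categorical random variables of length $N$ with $K$ categories, and let $1 \leq m \leq n \leq N$. Let $\Lambda^{m,n}$ be the $K \times K$ cross-covariance matrix of $\epsilon_m$ and $\epsilon_n$, whose entries are $\Lambda^{m,n}_{ij} = \mathrm{Cov}([\epsilon_m = i],[\epsilon_n = j])$. Then for all $i,j \in \{1,\dots,K\}$, $$\Lambda^{m,n}_{ij} = \begin{cases} \delta^{n-m} p_i(1-p_i), & i = j, \\ -\delta^{n-m} p_i p_j, & i \neq j. \end{cases}$$
   Context: Fix a number of categories $K \in \mathbb{N}$, probabilities $p_1,\dots,p_K \geq 0$ with $\sum_{i=1}^K p_i = 1$, and a dependency coefficient $0 \leq \delta \leq 1$ (with the convention $\delta^0 = 1$). Put $p_j^{+} = p_j + \delta(1-p_j)$ and $p_j^{-} = p_j - \delta p_j$ for $j = 1,\dots,K$. A sequence $(\epsilon_1,\dots,\epsilon_N)$ of random variables with values in $\{1,\dots,K\}$ is a sequentially dependent categorical sequence (with these parameters) if $P(\epsilon_1 = i) = p_i$ and, for $l \geq 2$, $P(\epsilon_l \mid \epsilon_1,\dots,\epsilon_{l-1}) = P(\epsilon_l \mid \epsilon_{l-1})$, with $P(\epsilon_l = j \mid \epsilon_{l-1} = j) = p_j^{+}$ and $P(\epsilon_l = j \mid \epsilon_{l-1} = i) = p_j^{-}$ for $i \neq j$. Equivalently, for $\omega \in \{1,\dots,K\}^N$, $$P\big((\epsilon_1,\dots,\epsilon_N) = \omega\big) = p_{\omega_1}\prod_{l=2}^{N}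 t(\omega_{l-1},\omega_l),$$ where $t(j,j) = p_j^{+}$ and $t(i,j) = p_j^{-}$ for $i \neq j$. $[\cdot]$ denotes the Iverson bracket, so $[\epsilon_m = i]$ is the random variable equal to $1$ if $\epsilon_m = i$ and $0$ otherwise. *)

(* Defs.v *)
(* Categories 1, ..., K are represented by 'I_K and the
   positions 1, ..., N of a sequence by 'I_N, both counted from 0. *)
From HB Require Import structures.
From mathcomp Require Import all_boot all_order all_algebra.
From mathcomp Require Import all_classical all_reals all_analysis.

Set Implicit Arguments.
Unset Strict Implicit.
Unset Printing Implicit Defensive.

Import Order.TTheory GRing.Theory Num.Theory.

Local Open Scope classical_set_scope.
Local Open Scope ring_scope.

(* P(A | B), meaningful only when P B != 0: division by zero yields 0. *)
Definition cond_prob (d : measure_display) (T : measurableType d)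
    (R : realType) (P : probability T R) (A B : set T) : R :=
  fine (P (A `&` B)) / fine (P B).

Definition p_plus (R : realType) (K : nat) (p : 'I_K -> R) (delta : R)
    (j : 'I_K) : R := p j + delta * (1 - p j).

Definition p_minus (R : realType) (K : nat) (p : 'I_K -> R) (delta : R)
    (j : 'I_K) : R := p j - delta * p j.

(* The event that eps_k = w k for every position k strictly before l. *)
Definition past_event (T : Type) (K N : nat) (eps : 'I_N -> T -> 'I_K)
    (l : 'I_N) (w : 'I_N -> 'I_K) : set T :=
  [set t | forall k : 'I_N, (k < l)%N -> eps k t = w k].

(* Measurability is with respect to the discrete sigma-algebra on 'I_K; it is
   spelled out because a measurableType is pointed, whereas 'I_K is empty for
   K = 0.  Conditional probabilities are constrained only when the conditioning
   event has nonzero probability. *)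
Record seq_dependent (d : measure_display) (T : measurableType d)
    (R : realType) (P : probability T R) (K N : nat) (p : 'I_K -> R)
    (delta : R) (eps : 'I_N -> T -> 'I_K) : Prop := SeqDependent {
  sd_measurable : forall (l : 'I_N) (A : set 'I_K),
    measurable (eps l @^-1` A) ;
  sd_initial : forall (l : 'I_N) (i : 'I_K), l = 0%N :> nat ->
    P (eps l @^-1` [set i]) = (p i)%:E ;
  sd_markov : forall (l l' : 'I_N) (w : 'I_N -> 'I_K) (j : 'I_K),
    l' = l.+1 :> nat ->
    P (past_event eps l' w) != 0%E ->
    cond_prob P (eps l' @^-1` [set j]) (past_event eps l' w) =
    cond_prob P (eps l' @^-1` [set j]) (eps l @^-1` [set w l]) ;
  sd_transition : forall (l l' : 'I_N) (i j : 'I_K),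
    l' = l.+1 :> nat ->
    P (eps l @^-1` [set i]) != 0%E ->
    cond_prob P (eps l' @^-1` [set j]) (eps l @^-1` [set i]) =
    if i == j then p_plus p delta j else p_minus p delta j
}.

(* The Iverson bracket [X = i], as a real random variable. *)
Definition iverson (T : Type) (R : realType) (K : nat) (X : T -> 'I_K)
    (i : 'I_K) : T -> R := fun t => (X t == i)%:R.
Arguments iverson {T} R {K} X i.

Definition cross_covariance (d : measure_display) (T : measurableType d)
    (R : realType) (P : probability T R) (K : nat) (X Y : T -> 'I_K)
    : 'M[\bar R]_K :=
  \matrix_(i, j) covariance P (iverson R X i) (iverson R Y j).

(* Main.v *)
(* The transition probability is t(i, j) = (1 - delta) p_j + delta [i = j].
   Summing over the value at time l shows that every eps_l has law p and that
   q_l := P(eps_m = i, eps_l = j) satisfies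
   q_(l+1) = (1 - delta) p_i p_j + delta q_l; hence q_l - p_i p_j, which is the
   covariance, is multiplied by delta at each step.  The joint law of eps_m,
   eps_l and eps_(l+1) is obtained from the Markov property by summing over the
   full pasts. *)
Require Import Defs.
From HB Require Import structures.
From mathcomp Require Import all_boot all_order all_algebra.
From mathcomp Require Import all_classical all_reals all_analysis.
From mathcomp Require Import ring.

Set Implicit Arguments.
Unset Strict Implicit.
Unset Printing Implicit Defensive.

Import Order.TTheory GRing.Theory Num.Theory.

Local Open Scope classical_set_scope.
Local Open Scope ring_scope.

Section FiniteValued.
Context (d : measure_display) (T : measurableType d) (R : realType).
Variable P : probability T R.

(** Law of total probability, used both for the value of a single [eps l] and for whole pasts
    encoded as finite functions. *)
Lemma fine_probability_partition (W : finType) (X : T -> W) (A : set T) :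
  measurable A -> (forall w, measurable (X @^-1` [set w])) ->
  fine (P A) = \sum_w fine (P (A `&` X @^-1` [set w])).
Proof.
move=> mA mX.
have mAX w : measurable (A `&` X @^-1` [set w]) by exact: measurableI.
rewrite sum_fine => [|w _]; last exact: fin_num_measure.
have eqA : A = \bigcup_(w in [set: W]) (A `&` X @^-1` [set w]).
  by apply/seteqP; split=> [t At|t [w _ []]//]; exists (X t).
rewrite [in LHS]eqA.
rewrite measure_fin_bigcup; [|exact: finite_finset| |by []]; last first.
  by move=> w1 w2 _ _ [t [[_ <-] [_ <-]]].
rewrite [in RHS]fsbig_seq ?index_enum_uniq //; congr (fine _).
by apply: eq_fsbigl; apply/seteqP; split=> w //= _; rewrite mem_index_enum.
Qed.

Lemma cond_prob_mul (A B : set T) : fine (P B) != 0 ->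
  fine (P (A `&` B)) = fine (P B) * cond_prob P A B.
Proof. by move=> PB0; rewrite /cond_prob mulrC divfK. Qed.

Lemma fine_probability_neq0 (A : set T) : measurable A ->
  (fine (P A) != 0) = (P A != 0%E).
Proof. by move=> mA; rewrite fine_eq0 // fin_num_measure. Qed.

Lemma fine_probability_sub0 (A B : set T) : measurable A -> measurable B ->
  A `<=` B -> fine (P B) = 0 -> fine (P A) = 0.
Proof.
move=> mA mB sAB PB0; apply/eqP; rewrite eq_le fine_ge0 ?measure_ge0 // andbT.
by rewrite -PB0 fine_le ?fin_num_measure // le_measure ?inE.
Qed.

Lemma Lfun1_indic (A : set T) : measurable A -> (\1_A : T -> R) \in Lfun P 1.
Proof. by move=> mA; apply/Lfun1_integrable; exact: integrable_indic. Qed.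

Lemma covariance_indic (A B : set T) : measurable A -> measurable B ->
  covariance P \1_A \1_B = (fine (P (A `&` B)) - fine (P A) * fine (P B))%:E.
Proof.
move=> mA mB; have mAB : measurable (A `&` B) by exact: measurableI.
have indicM : (\1_A : T -> R) * \1_B = \1_(A `&` B) by rewrite indicI.
rewrite covarianceE ?indicM ?Lfun1_indic // !expectation_indic //.
by rewrite EFinB EFinM !fineK // fin_num_measure.
Qed.

Lemma iversonE (K : nat) (X : T -> 'I_K) (i : 'I_K) :
  iverson R X i = \1_(X @^-1` [set i]).
Proof.
apply/funext => t; rewrite /iverson indicE; congr (_%:R).
by congr nat_of_bool; apply/eqP/idP; rewrite inE.
Qed.

End FiniteValued.

Definition transition (R : realType) (K : nat) (p : 'I_K -> R) (delta : R)
    (i j : 'I_K) : R :=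
  if i == j then p_plus p delta j else p_minus p delta j.

Lemma transitionE (R : realType) (K : nat) (p : 'I_K -> R) (delta : R)
    (i j : 'I_K) :
  transition p delta i j = (1 - delta) * p j + delta * (i == j)%:R.
Proof.
rewrite /transition /p_plus /p_minus.
by case: eqP => _; rewrite ?mulr1n ?mulr0n; ring.
Qed.

(** One step of the chain applied to a row vector [a]: besides [a j], only the total mass of [a]
    matters. This gives the recursions for marginal and joint laws. *)
Lemma sum_transition (R : realType) (K : nat) (p : 'I_K -> R) (delta : R)
    (a : 'I_K -> R) (j : 'I_K) :
  \sum_i a i * transition p delta i j =
  (1 - delta) * p j * (\sum_i a i) + delta * a j.
Proof.
under eq_bigr do rewrite transitionE mulrDr.
rewrite big_split /= -mulr_suml [(\sum_i _) * _]mulrC; congr (_ + _).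
rewrite (bigD1 j) //= eqxx big1 ?addr0 => [|i /negbTE->].
  by rewrite mulr1n; ring.
by rewrite mulr0n !mulr0.
Qed.

Section SequentialDependence.
Context (d : measure_display) (T : measurableType d) (R : realType).
Variables (P : probability T R) (K N : nat) (p : 'I_K -> R) (delta : R).
Variable eps : 'I_N -> T -> 'I_K.
Hypothesis eps_sd : seq_dependent P p delta eps.
Hypothesis sum_p : \sum_(i < K) p i = 1.

Let meps (l : 'I_N) (A : set 'I_K) : measurable (eps l @^-1` A).
Proof. exact: (sd_measurable eps_sd). Qed.

Lemma past_eventE (l : 'I_N) (w : 'I_N -> 'I_K) :
  past_event eps l w =
  \bigcap_(k in [set k : 'I_N | (k < l)%N]) eps k @^-1` [set w k].
Proof. by []. Qed.

Lemma measurable_past_event (l : 'I_N) (w : 'I_N -> 'I_K) :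
  measurable (past_event eps l w).
Proof. by rewrite past_eventE; apply: fin_bigcap_measurable. Qed.

Lemma past_event_step (l l' : 'I_N) (w : 'I_N -> 'I_K) (j : 'I_K) :
  l' = l.+1 :> nat ->
  fine (P (eps l' @^-1` [set j] `&` past_event eps l' w)) =
  fine (P (past_event eps l' w)) * transition p delta (w l) j.
Proof.
move=> l'E; have mw := measurable_past_event l' w.
have mjw : measurable (eps l' @^-1` [set j] `&` past_event eps l' w).
  exact: measurableI.
(* The Markov hypothesis is silent on null pasts, but there both sides vanish. *)
have [w0|w0] := eqVneq (fine (P (past_event eps l' w))) 0.
  by rewrite w0 mul0r; apply: fine_probability_sub0 w0 => // t [].
(* Since [l < l'], the past event lies inside this one, which is therefore not null either. *)
have wl0 : P (eps l @^-1` [set w l]) != 0%E.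
  rewrite -fine_probability_neq0 //; apply: contra_neq w0.
  by apply: fine_probability_sub0 => // t /(_ l); apply; rewrite l'E.
rewrite cond_prob_mul // (sd_markov eps_sd _ l'E) -?fine_probability_neq0 //.
by rewrite (sd_transition eps_sd).
Qed.

(** The last hypothesis says that [A] is determined by the coordinates before [l']. So [A] is a
    finite disjoint union of past events, all with value [i] at [l], and [past_event_step] can be
    summed over them. *)
Lemma markov_step (l l' : 'I_N) (A : set T) (i j : 'I_K) :
  l' = l.+1 :> nat -> measurable A -> A `<=` eps l @^-1` [set i] ->
  (forall s t, (forall k : 'I_N, (k < l')%N -> eps k s = eps k t) ->
     A s -> A t) ->
  fine (P (A `&` eps l' @^-1` [set j])) =
  fine (P A) * transition p delta i j.
Proof.
move=> l'E mA Ai Apast.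
(* Coordinates at l' and later are frozen, so that the fibres of this
   finite-valued map are exactly the nonempty past events. *)
pose past t := [ffun k : 'I_N => if (k < l')%N then eps k t else i].
have past_eq t : past @^-1` [set past t] = past_event eps l' (eps^~ t).
  apply/seteqP; split=> s /= => [/ffunP st k kl'|st].
    by have := st k; rewrite !ffunE kl'.
  by apply/ffunP => k; rewrite !ffunE; case: ifP => // /st.
have mpast w : measurable (past @^-1` [set w]).
  have [[t <-]|nw] := pselect (exists t, past t = w).
    by rewrite past_eq; exact: measurable_past_event.
  suff -> : past @^-1` [set w] = set0 by [].
  by apply/seteqP; split=> // t tw; apply: nw; exists t.
rewrite (fine_probability_partition P _ mpast); last exact: measurableI.
rewrite (fine_probability_partition P mA mpast) mulr_suml.
apply: eq_bigr => w _.
(* Each fibre of [past] is either disjoint from [A] or contained in it. *)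
have [[t [At <-]]|nw] := pselect (exists t, A t /\ past t = w); last first.
  have A0 : A `&` past @^-1` [set w] = set0.
    by apply/seteqP; split=> // t [At tw]; apply: nw; exists t.
  by rewrite setIAC A0 set0I measure0 mul0r.
have Aw : A `&` past @^-1` [set past t] = past_event eps l' (eps^~ t).
  rewrite past_eq; apply/setIidr => s st; apply: Apast At => k kl'.
  by rewrite st.
by rewrite setIAC Aw setIC (past_event_step _ _ l'E) (Ai t At).
Qed.

(** The law [p] is stationary: (1 - delta) p_i + delta p_i = p_i, because [p] has total mass 1. *)
Lemma marginal_prob (l : 'I_N) (i : 'I_K) :
  fine (P (eps l @^-1` [set i])) = p i.
Proof.
case: l i => l; elim: l => [|l IH] lN i.
  by rewrite (sd_initial eps_sd).
pose l0 := Ordinal (ltnW lN).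
rewrite (fine_probability_partition P (X := eps l0)) //.
under eq_bigr => k _.
  rewrite setIC (@markov_step l0 _ _ k) //; last first.
    by move=> s t st /=; rewrite -st.
  rewrite IH; over.
by rewrite sum_transition sum_p; ring.
Qed.

(** The second summand is the covariance, with the cases i = j and i != j merged so that one
    recursion on [n] serves both. *)
Lemma joint_prob (m n : 'I_N) (i j : 'I_K) : (m <= n)%N ->
  fine (P (eps m @^-1` [set i] `&` eps n @^-1` [set j])) =
  p i * p j + delta ^+ (n - m) * p i * ((i == j)%:R - p j).
Proof.
have mI (l l' : 'I_N) (a b : 'I_K) :
  measurable (eps l @^-1` [set a] `&` eps l' @^-1` [set b]).
  exact: measurableI.
(* The base case n = m; it can occur at any stage of the induction, which runs over the natural
   number underlying [n]. *)
have joint_diag (l : 'I_N) (b : 'I_K) : m = l :> nat ->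
    fine (P (eps m @^-1` [set i] `&` eps l @^-1` [set b])) =
    p i * p b + delta ^+ (l - m) * p i * ((i == b)%:R - p b).
  move=> /val_inj <-; rewrite subnn expr0 mul1r.
  have [<-|ib] := eqVneq i b; first by rewrite setIid marginal_prob mulr1n; ring.
  have -> : eps m @^-1` [set i] `&` eps m @^-1` [set b] = set0.
    by apply/seteqP; split=> // t [ti tb]; case/eqP: ib; rewrite -ti -tb.
  by rewrite measure0 mulr0n /=; ring.
case: n => n; elim: n j => [|n IH] j nN /=; rewrite leq_eqVlt => /predU1P[mn|].
- exact: joint_diag.
- by [].
- exact: joint_diag.
rewrite ltnS => mn; pose n0 := Ordinal (ltnW nN).
rewrite (fine_probability_partition P (X := eps n0)) //.
(* The event that [eps m] is [i] and [eps n0] is [k] depends only on coordinates before n0 + 1, as m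
   <= n0. *)
under eq_bigr => k _.
  rewrite setIAC (@markov_step n0 _ _ k) //; last first.
    by move=> s t st [/= <- <-]; rewrite !st.
  over.
(* Summed over k, the joint masses recombine into the marginal p_i of [eps m]. *)
rewrite sum_transition -(fine_probability_partition P (X := eps n0)) //.
by rewrite marginal_prob IH // subSn // exprS; ring.
Qed.

End SequentialDependence.

Theorem theorem1 (d : measure_display) (T : measurableType d) (R : realType)
    (P : probability T R) (K N : nat) (p : 'I_K -> R) (delta : R)
    (p_ge0 : forall i : 'I_K, 0 <= p i) (sum_p : \sum_(i < K) p i = 1)
    (delta_ge0 : 0 <= delta) (delta_le1 : delta <= 1)
    (eps : 'I_N -> T -> 'I_K) (eps_sd : seq_dependent P p delta eps)
    (m n : 'I_N) (le_mn : (m <= n)%N) (i j : 'I_K) :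
  cross_covariance P (eps m) (eps n) i j =
  (if i == j then delta ^+ (n - m) * p i * (1 - p i)
   else - (delta ^+ (n - m) * p i * p j))%:E.
Proof.
rewrite mxE !iversonE covariance_indic; last 2 first.
- exact: (sd_measurable eps_sd).
- exact: (sd_measurable eps_sd).
(* The product of the marginals cancels the term p_i p_j of the joint law. *)
rewrite (joint_prob eps_sd sum_p) // !(marginal_prob eps_sd sum_p).
by congr EFin; case: eqVneq => [<-|_]; rewrite ?mulr1n ?mulr0n; ring.
Qed.
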